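(* Let $G$ be a graph with clique number $\omega=\omega(G)$, and for $1\le s\le\omega$ let $k_s(G)$ be the number of $s$-cliques of $G$. Then $$\frac{k_1(G)}{\binom{\omega}{1}}\ \ge\ \left(\frac{k_2(G)}{\binom{\omega}{2}}\right)^{1/2}\ \ge\ \cdots\ \ge\ \left(\frac{k_\omega(G)}{\binom{\omega}{\omega}}\right)^{1/\omega}.$$
   Context: Graphs are finite, simple and undirected, with vertex set $[n]=\{1,\ldots,n\}$, $n\ge 1$. An $s$-clique of $G$ is a set of $s$ pairwise adjacent vertices, and $\omega(G)$ is the size of a largest clique of $G$. *)

(* Defs.v *)
From mathcomp Require Import all_boot all_order all_algebra.
From mathcomp Require Import reals exp.

Set Implicit Arguments.
Unset Strict Implicit.
Unset Printing Implicit Defensive.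

(* The vertex set [n] = {1, ..., n} is rendered as 'I_n = {0, ..., n - 1}. *)
Record sgraph (n : nat) := SGraph {
  adj :> rel 'I_n;
  adj_sym : symmetric adj;
  adj_irr : irreflexive adj
}.

Definition clique n (G : sgraph n) (A : {set 'I_n}) : bool :=
  [forall x in A, forall y in A, (x != y) ==> G x y].

Definition nb_cliques n (G : sgraph n) (s : nat) : nat :=
  #|[set A : {set 'I_n} | clique G A && (#|A| == s)]|.

Definition clique_number n (G : sgraph n) : nat :=
  \max_(A : {set 'I_n} | clique G A) #|A|.

(* Main.v *)
Require Import Defs.
From mathcomp Require Import all_boot all_order all_algebra.
From mathcomp Require Import reals exp.
From mathcomp Require Import ring lra.
Import Order.TTheory GRing.Theory Num.Theory.
Local Open Scope ring_scope.

(** Give the vertices nonnegative weights [x i] and let [wcliques s x] be the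
    sum, over all [s]-cliques, of the product of the weights; at the constant
    weight 1 it counts the [s]-cliques.  The argument is of Motzkin-Straus type.

    If [i] and [j] are distinct and nonadjacent, no clique contains both, so
    [wcliques s] and [wcliques s.+1] are jointly affine in [(x i, x j)], without a
    product term.  On the segment of pairs [(x i, x j)] that keeps [wcliques s]
    fixed, [wcliques s.+1] is affine, hence does not decrease towards one of the
    two endpoints, and there one of the two weights vanishes
    ([segment_endpoint]).  Repeating this, [clique_support] moves all the weight
    onto a clique without changing [wcliques s] and without decreasing
    [wcliques s.+1].

    On a clique, [wcliques s] is the elementary symmetric polynomial of degree
    [s] in at most [w] nonnegative weights, where [w] is the clique number.
    Padded with zeros to exactly [w] weights, it obeys Maclaurin's inequality
    ([maclaurin_padded]), which is the claim raised to the power [s * s.+1].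
    Maclaurin's inequality follows from the log-concavity of the elementary
    symmetric means, that is from Newton's inequalities ([newton]); these are
    proved by adding one variable at a time, a form that allows zero weights. *)

(** * Newton's inequalities *)

Section Newton.
Set Implicit Arguments.
Unset Strict Implicit.
Variable R : realFieldType.
Implicit Types (a c d em : R) (r : seq R).

(** Multiplying two consecutive Newton inequalities and cancelling [e0 * e1]
    bounds the product of the outer terms.  The two vanishing hypotheses (no
    internal zeros) cover the case where nothing can be cancelled. *)
Lemma newton_cross c d em (e0 e1 e2 : R) :
  1 <= c -> 1 <= d -> 0 <= em -> 0 <= e0 -> 0 <= e1 -> 0 <= e2 ->
  (e0 = 0 -> e1 = 0) -> (e1 = 0 -> e2 = 0) ->
  c * (d + 1) * (em * e1) <= (c - 1) * d * e0 ^+ 2 ->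
  (c + 1) * d * (e0 * e2) <= c * (d - 1) * e1 ^+ 2 ->
  (c + 1) * (d + 1) * (em * e2) <= (c - 1) * (d - 1) * (e0 * e1).
Proof.
move=> c1 d1 em0 e00 e10 e20 z01 z12 H0 H1.
have [/eqP e1z|e1n] := boolP (e1 == 0).
  by rewrite (z12 e1z) e1z !mulr0.
have e0n : e0 != 0 by apply: contra_neq e1n.
have P : 0 < c * d * (e0 * e1).
  rewrite !mulr_gt0 ?lt0r ?e0n ?e1n //; lra.
rewrite -(ler_pM2l P).
have -> : c * d * (e0 * e1) * ((c + 1) * (d + 1) * (em * e2)) =
  (c * (d + 1) * (em * e1)) * ((c + 1) * d * (e0 * e2)) by ring.
have -> : c * d * (e0 * e1) * ((c - 1) * (d - 1) * (e0 * e1)) =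
  ((c - 1) * d * e0 ^+ 2) * (c * (d - 1) * e1 ^+ 2) by ring.
apply: ler_pM => //.
- by rewrite !mulr_ge0 //; lra.
- by rewrite !mulr_ge0 //; lra.
Qed.

(** The inductive step of Newton's inequalities.  Here [em, e0, e1, e2] are the
    elementary symmetric sums of degrees [k-1, k, k+1, k+2] in [N] variables,
    [a] is a new variable, [c = k+1] and [d = N-k]; the last two hypotheses are
    Newton's inequalities in degrees [k] and [k+1] for [N] variables, and the
    conclusion is the one in degree [k+1] for [N+1] variables. *)
Lemma newton_step c d a em (e0 e1 e2 : R) :
  1 <= c -> 1 <= d -> 0 <= a ->
  0 <= em -> 0 <= e0 -> 0 <= e1 -> 0 <= e2 ->
  (e0 = 0 -> e1 = 0) -> (e1 = 0 -> e2 = 0) ->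
  c * (d + 1) * (em * e1) <= (c - 1) * d * e0 ^+ 2 ->
  (c + 1) * d * (e0 * e2) <= c * (d - 1) * e1 ^+ 2 ->
  (c + 1) * (d + 1) * ((e0 + a * em) * (e2 + a * e1))
    <= c * d * (e1 + a * e0) ^+ 2.
Proof.
move=> c1 d1 a0 em0 e00 e10 e20 z01 z12 H0 H1.
have HX : (c + 1) * (d + 1) * (em * e2) <= (c - 1) * (d - 1) * (e0 * e1).
  exact: newton_cross.
have P : 0 < c * d by rewrite mulr_gt0 //; lra.
rewrite -(ler_pM2l P) -subr_ge0.
(* Up to the factor [c * d], the defect is a square plus nonnegative multiples of
   the defects of the three hypotheses [H1], [HX] and [H0]. *)
have -> : c * d * (c * d * (e1 + a * e0) ^+ 2) -
    c * d * ((c + 1) * (d + 1) * ((e0 + a * em) * (e2 + a * e1))) =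
  (c * e1 - a * d * e0) ^+ 2
  + c * (d + 1) * (c * (d - 1) * e1 ^+ 2 - (c + 1) * d * (e0 * e2))
  + a * (c * d) * ((c - 1) * (d - 1) * (e0 * e1) - (c + 1) * (d + 1) * (em * e2))
  + a ^+ 2 * (d * (c + 1)) * ((c - 1) * d * e0 ^+ 2 - c * (d + 1) * (em * e1)).
  by ring.
by rewrite !addr_ge0 ?sqr_ge0 // !mulr_ge0 ?subr_ge0 ?sqr_ge0 //; lra.
Qed.

(** The coefficient of degree [k] is the [k]-th elementary symmetric sum of [r]. *)
Definition esym_gen r : {poly R} := \prod_(a <- r) (1 + a *: 'X).

Lemma coef_esym_gen_cons0 a r : (esym_gen (a :: r))`_0 = (esym_gen r)`_0.
Proof.
by rewrite /esym_gen big_cons mulrDl mul1r coefD -scalerAl coefZ coefXM /= mulr0 addr0.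
Qed.

Lemma coef_esym_gen_consS a r k :
  (esym_gen (a :: r))`_k.+1 = (esym_gen r)`_k.+1 + a * (esym_gen r)`_k.
Proof.
by rewrite /esym_gen big_cons mulrDl mul1r coefD -scalerAl coefZ coefXM.
Qed.

Lemma coef_esym_gen0 r : (esym_gen r)`_0 = 1.
Proof.
elim: r => [|a r IH]; first by rewrite /esym_gen big_nil coef1.
by rewrite coef_esym_gen_cons0.
Qed.

Lemma coef_esym_gen_ge0 r k : all (>= 0) r -> 0 <= (esym_gen r)`_k.
Proof.
elim: r k => [|a r IH] k /=.
  by rewrite /esym_gen big_nil coef1; case: k.
case/andP=> a0 r0; case: k => [|k]; first by rewrite coef_esym_gen_cons0 IH.
by rewrite coef_esym_gen_consS addr_ge0 ?mulr_ge0 ?IH.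
Qed.

Lemma coef_esym_gen_gt r k : (size r < k)%N -> (esym_gen r)`_k = 0.
Proof.
elim: r k => [|a r IH] [|k] //=; first by rewrite /esym_gen big_nil coef1.
by move=> lrk; rewrite coef_esym_gen_consS !IH ?mulr0 ?addr0 // ltnW.
Qed.

(** Some product of [k.+1] entries is nonzero only if some product of [k] entries
    is; thus the sequence of coefficients has no internal zeros. *)
Lemma coef_esym_gen_eq0 r k : all (>= 0) r ->
  (esym_gen r)`_k = 0 -> (esym_gen r)`_k.+1 = 0.
Proof.
elim: r k => [|a r IH] k /=; first by rewrite /esym_gen big_nil !coef1.
case/andP=> a0 r0; case: k => [|k].
  by rewrite coef_esym_gen0 => /eqP; rewrite oner_eq0.
rewrite !coef_esym_gen_consS => /eqP.
rewrite paddr_eq0 ?mulr_ge0 ?coef_esym_gen_ge0 // => /andP[/eqP z _].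
by rewrite z IH // mulr0 addr0.
Qed.

(** Newton's inequalities, cleared of binomial coefficients: dividing each
    coefficient by its binomial turns this into [esym_mean_log_concave]. *)
Lemma newton r k : all (>= 0) r ->
  (k.+2)%:R * ((size r)%:R - k%:R) * ((esym_gen r)`_k * (esym_gen r)`_k.+2)
  <= (k.+1)%:R * ((size r)%:R - k.+1%:R) * (esym_gen r)`_k.+1 ^+ 2.
Proof.
elim: r k => [|a r IH] k.
  by rewrite /esym_gen big_nil !coef1 /= !mulr0 expr0n mulr0.
rewrite [all _ _]/= => /andP[a0 r0].
have [krS|krN] := ltnP k (size r); last first.
  (* The left side vanishes by degree; on the right, either the numerical factor
     is zero or the squared coefficient is. *)
  rewrite (@coef_esym_gen_gt (a :: r) k.+2) ?ltnS // !mulr0.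
  have [->|kne] := eqVneq k (size r).
    by rewrite /= subrr mulr0 mul0r.
  rewrite (@coef_esym_gen_gt (a :: r) k.+1) ?expr0n ?mulr0 //= ltnS.
  by rewrite ltn_neqAle eq_sym kne.
(* The coefficient of degree [k-1], read as 0 when [k = 0]. *)
pose em : R := if k is k'.+1 then (esym_gen r)`_k' else 0.
have Ek : (esym_gen (a :: r))`_k = (esym_gen r)`_k + a * em.
  rewrite /em; case: (k) => [|k']; first by rewrite coef_esym_gen_cons0 mulr0 addr0.
  exact: coef_esym_gen_consS.
have em0 : 0 <= em by rewrite /em; case: (k) => // k'; exact: coef_esym_gen_ge0.
rewrite Ek !coef_esym_gen_consS.
have d1 : 1 <= (size r)%:R - k%:R :> R.
  by rewrite lerBrDr -[1]/(1%:R) -natrD ler_nat add1n.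
have H1 := IH k r0.
have H0 : k.+1%:R * ((size r)%:R - k%:R + 1) * (em * (esym_gen r)`_k.+1)
     <= (k.+1%:R - 1) * ((size r)%:R - k%:R) * (esym_gen r)`_k ^+ 2.
  rewrite /em; case: (k) IH => [|k'] IH'; first by rewrite mul0r mulr0 subrr !mul0r.
  have := IH' k' r0.
  have -> : (size r)%:R - k'.+1%:R + 1 = (size r)%:R - k'%:R :> R.
    by rewrite -[k'.+1]addn1 natrD; ring.
  by have -> : k'.+2%:R - 1 = k'.+1%:R :> R by rewrite -[k'.+2]addn1 natrD; ring.
have := @newton_step k.+1%:R ((size r)%:R - k%:R) a em
  (esym_gen r)`_k (esym_gen r)`_k.+1 (esym_gen r)`_k.+2.
have -> : k.+1%:R + 1 = k.+2%:R :> R by rewrite -[k.+2]addn1 natrD.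
have -> : (size (a :: r))%:R - k%:R = (size r)%:R - k%:R + 1 :> R.
  by rewrite /= -[(size r).+1]addn1 natrD; ring.
have -> : (size (a :: r))%:R - k.+1%:R = (size r)%:R - k%:R :> R.
  by rewrite /= -[(size r).+1]addn1 -[k.+1]addn1 !natrD; ring.
apply=> //; rewrite ?coef_esym_gen_ge0 //.
- by rewrite ler1n.
- exact: coef_esym_gen_eq0.
- exact: coef_esym_gen_eq0.
- apply: le_trans H1 _.
  by rewrite -[k.+1]addn1 natrD opprD addrA.
Qed.

(** * Maclaurin's inequality *)

Definition esym_mean r k : R := (esym_gen r)`_k / 'C(size r, k)%:R.

Lemma esym_mean_ge0 r k : all (>= 0) r -> 0 <= esym_mean r k.
Proof. by move=> r0; rewrite divr_ge0 ?coef_esym_gen_ge0. Qed.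

Lemma esym_mean_log_concave r k : all (>= 0) r -> (k.+1 < size r)%N ->
  esym_mean r k * esym_mean r k.+2 <= esym_mean r k.+1 ^+ 2.
Proof.
move=> r0 kr; have := newton k r0.
rewrite /esym_mean.
set e0 := _`_k; set e1 := _`_k.+1; set e2 := _`_k.+2.
move: kr; set N := size r => kr.
have b0 : 0 < 'C(N, k)%:R :> R by rewrite ltr0n bin_gt0 ltnW // ltnW.
have b1 : 0 < 'C(N, k.+1)%:R :> R by rewrite ltr0n bin_gt0 ltnW.
have b2 : 0 < 'C(N, k.+2)%:R :> R by rewrite ltr0n bin_gt0.
have E1 : k.+1%:R * 'C(N, k.+1)%:R = (N%:R - k%:R) * 'C(N, k)%:R :> R.
  by rewrite -natrB -?natrM ?mul_bin_left // ltnW // ltnW.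
have E2 : k.+2%:R * 'C(N, k.+2)%:R = (N%:R - k.+1%:R) * 'C(N, k.+1)%:R :> R.
  by rewrite -natrB -?natrM ?mul_bin_left // ltnW.
have D0 : 0 < N%:R - k.+1%:R :> R by rewrite subr_gt0 ltr_nat.
have D1 : 0 < N%:R - k%:R :> R by rewrite subr_gt0 ltr_nat ltnW.
have K1 : 0 < k.+1%:R :> R by rewrite ltr0n.
have K2 : 0 < k.+2%:R :> R by rewrite ltr0n.
move: D0 D1 K1 K2 b0 b1 b2 E1 E2.
move: (k.+2%:R : R) (N%:R - k.+1%:R : R) => K2 D0.
move: (k.+1%:R : R) (N%:R - k%:R : R) => K1 D1.
move: ('C(N, k)%:R : R) ('C(N, k.+1)%:R : R) ('C(N, k.+2)%:R : R) => b0 b1 b2.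
move=> D0p D1p K1p K2p b0p b1p b2p E1 E2 H.
have E0' : b0 = K1 * b1 / D1 by rewrite E1 mulrC mulKf // gt_eqF.
have E2' : b2 = D0 * b1 / K2 by rewrite -E2 mulrC mulKf // gt_eqF.
rewrite E0' E2'.
have -> : e0 / (K1 * b1 / D1) * (e2 / (D0 * b1 / K2)) =
   (K2 * D1 * (e0 * e2)) / (K1 * D0 * b1 ^+ 2).
  by field; rewrite !gt_eqF.
have -> : (e1 / b1) ^+ 2 = (K1 * D0 * e1 ^+ 2) / (K1 * D0 * b1 ^+ 2).
  by field; rewrite !gt_eqF.
by rewrite ler_pM2r // invr_gt0 !mulr_gt0 // exprn_gt0.
Qed.

(** Stated with powers so that no roots are needed.  By induction on [k]: writing
    [p] for the means, log-concavity raised to the power [k.+1] and the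
    induction hypothesis give
    [p k.+1 ^ (2 k.+1) >= p k ^ k.+1 * p k.+2 ^ k.+1
                       >= p k.+1 ^ k * p k.+2 ^ k.+1],
    and [p k.+1 ^ k] cancels unless [p k.+1 = 0], in which case [p k.+2 = 0]. *)
Lemma maclaurin r k : all (>= 0) r -> (k < size r)%N ->
  esym_mean r k.+1 ^+ k <= esym_mean r k ^+ k.+1.
Proof.
move=> r0; elim: k => [|k IH] kr.
  by rewrite expr0 expr1 /esym_mean coef_esym_gen0 bin0 divr1.
have P j : 0 <= esym_mean r j by exact: esym_mean_ge0.
have [z|nz] := eqVneq (esym_mean r k.+1) 0.
  suff -> : esym_mean r k.+2 = 0 by rewrite expr0n /= exprn_ge0.
  move/eqP: z; rewrite /esym_mean mulf_eq0 invr_eq0 pnatr_eq0 -leqn0 leqNgt.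
  rewrite bin_gt0 (ltnW kr) orbF => /eqP z.
  by rewrite coef_esym_gen_eq0 // mul0r.
have Pk : 0 < esym_mean r k.+1 ^+ k by rewrite exprn_gt0 // lt0r nz P.
rewrite -(ler_pM2l Pk) -exprD.
apply: (@le_trans _ _ (esym_mean r k ^+ k.+1 * esym_mean r k.+2 ^+ k.+1)).
  by rewrite ler_wpM2r ?exprn_ge0 ?IH // ltnW.
have -> : (k + k.+2 = 2 * k.+1)%N by rewrite mul2n -addnn addSnnS.
rewrite -exprMn exprM.
rewrite lerXn2r ?nnegrE ?sqr_ge0 ?esym_mean_log_concave //.
by apply: mulr_ge0; exact: P.
Qed.

Lemma esym_gen_nseq0 r m : esym_gen (r ++ nseq m 0) = esym_gen r.
Proof.
rewrite /esym_gen big_cat /= big_nseq.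
have -> : iter m ( *%R (1 + 0 *: 'X)) 1 = 1 :> {poly R}.
  by elim: m => //= m ->; rewrite scale0r addr0 mulr1.
by rewrite mulr1.
Qed.

Lemma maclaurin_padded r N k : all (>= 0) r -> (size r <= N)%N -> (k < N)%N ->
  ((esym_gen r)`_k.+1 / 'C(N, k.+1)%:R) ^+ k
    <= ((esym_gen r)`_k / 'C(N, k)%:R) ^+ k.+1.
Proof.
move=> r0 rN kN; pose r' := r ++ nseq (N - size r) 0.
have sr' : size r' = N by rewrite size_cat size_nseq subnKC.
have r'0 : all (>= 0) r' by rewrite all_cat r0 all_nseq lexx orbT.
by have := @maclaurin r' k r'0; rewrite /esym_mean sr' esym_gen_nseq0; apply.
Qed.

End Newton.

(** * Weighted clique counts *)

Section WeightedCliques.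
Set Implicit Arguments.
Unset Strict Implicit.
Variables (R : realFieldType) (n : nat) (G : sgraph n).
Implicit Types (x y : 'I_n -> R) (A B : {set 'I_n}) (s : nat).

Definition wcliques s x : R :=
  \sum_(A | clique G A && (#|A| == s)) \prod_(i in A) x i.

Definition wsupp x : {set 'I_n} := [set i | x i != 0].

Lemma cliqueP A :
  reflect {in A &, forall i j, i != j -> G i j} (clique G A).
Proof.
apply: (iffP forall_inP) => [h i j iA jA|h i iA].
  by move/forall_inP: (h i iA) => /(_ j jA) /implyP.
by apply/forall_inP => j jA; apply/implyP; exact: h.
Qed.

Lemma cliqueS A B : A \subset B -> clique G B -> clique G A.
Proof.
move=> /subsetP sAB /cliqueP h; apply/cliqueP => i j iA jA.
by apply: h; apply: sAB.
Qed.

Lemma clique_card A : clique G A -> (#|A| <= clique_number G)%N.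
Proof. by move=> cA; rewrite /clique_number leq_bigmax_cond. Qed.

Lemma wcliques1 s : wcliques s (fun=> 1) = (nb_cliques G s)%:R.
Proof.
rewrite /wcliques /nb_cliques -sumr_const.
by apply: eq_big => [A|A _]; [rewrite inE | rewrite big1].
Qed.

(** A set not contained in the support contributes a zero product, and every
    subset of the support is a clique, so the sum runs over all sets of size [s]. *)
Lemma wcliques_esym s x : clique G (wsupp x) ->
  wcliques s x = (esym_gen [seq x i | i <- enum (wsupp x)])`_s.
Proof.
move=> cx.
have -> : esym_gen [seq x i | i <- enum (wsupp x)]
          = \prod_i (x i *: 'X + 1).
  rewrite /esym_gen big_map big_enum /=.
  rewrite [RHS](bigID (mem (wsupp x))) /= [X in _ * X]big1 ?mulr1.
    by apply: eq_bigr => i _; rewrite addrC.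
  by move=> i; rewrite inE negbK => /eqP->; rewrite scale0r add0r.
rewrite bigA_distr coef_sum /wcliques big_mkcond /=.
apply: eq_bigr => A _.
rewrite -big_mkcond /= scaler_prod prodr_const coefZ coefXn eq_sym.
case: eqP; rewrite ?(andbF, mulr0) // mulr1 andbT => _.
case: ifP => // /negP ncA.
have /subsetPn[i iA] : ~~ (A \subset wsupp x).
  by apply/negP => sA; apply: ncA; exact: cliqueS cx.
rewrite inE negbK => /eqP xi0.
by rewrite (bigD1 i) //= xi0 mul0r.
Qed.

(** The partial derivative of [wcliques s] with respect to [x i]. *)
Definition wderiv s x i : R :=
  \sum_(A | (clique G A && (#|A| == s)) && (i \in A)) \prod_(j in A :\ i) x j.

Lemma wderiv_ge0 s x i : (forall j, 0 <= x j) -> 0 <= wderiv s x i.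
Proof. by move=> x0; apply: sumr_ge0 => A _; apply: prodr_ge0. Qed.

(** Removing from an [s.+1]-clique through [i] a vertex other than [i] leaves an
    [s]-clique through [i], whose product vanishes and divides the larger one. *)
Lemma wderiv_eq0 s x i : (0 < s)%N -> (forall j, 0 <= x j) ->
  wderiv s x i = 0 -> wderiv s.+1 x i = 0.
Proof.
move=> s0 x0 /eqP.
rewrite psumr_eq0; last by move=> A _; apply: prodr_ge0.
move/allP => h; apply: big1 => A /andP[/andP[cA /eqP sA] iA].
have /card_gt0P[t] : (0 < #|A :\ i|)%N.
  by have := cardsD1 i A; rewrite iA sA add1n => -[<-].
rewrite !inE => /andP[ti tA].
have /implyP := h (A :\ t) (mem_index_enum _).
rewrite (cliqueS (subsetDl _ _) cA) /= !inE [i == t]eq_sym ti iA !andbT.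
have -> : #|A :\ t| == s by have := cardsD1 t A; rewrite tA sA add1n => -[<-].
move/(_ isT)/eqP => z.
rewrite (bigD1 t) ?inE ?ti //=.
rewrite [X in _ * X](_ : _ = 0) ?mulr0 // -[RHS]z.
by apply: eq_bigl => j; rewrite !inE andbAC -andbA.
Qed.

Definition update2 x i j u v : 'I_n -> R :=
  fun k => if k == i then u else if k == j then v else x k.

(** The part of [wcliques s x] that involves neither [x i] nor [x j]. *)
Definition wrest s x i j : R :=
  \sum_(A | (clique G A && (#|A| == s)) && ~~ ((i \in A) || (j \in A)))
    \prod_(k in A) x k.

(** Joint affinity in two nonadjacent weights: no clique contains both [i] and
    [j], so every clique falls into exactly one of the three sums. *)
Lemma wcliques_update2 s x i j u v : i != j -> ~~ G i j ->
  wcliques s (update2 x i j u v) =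
    wrest s x i j + u * wderiv s x i + v * wderiv s x j.
Proof.
move=> ij Gij.
have nij A : clique G A -> i \in A -> j \in A -> False.
  by move=> /cliqueP h iA jA; rewrite (h i j) in Gij.
rewrite /wcliques (bigID (fun A => (i \in A) || (j \in A))) /= addrC -addrA.
congr (_ + _).
  apply: eq_bigr => A /andP[_]; rewrite negb_or => /andP[iA jA].
  apply: eq_bigr => k kA; rewrite /update2.
  have -> : (k == i) = false by apply: contraNF iA => /eqP <-.
  by have -> : (k == j) = false by apply: contraNF jA => /eqP <-.
rewrite (bigID (fun A => i \in A)) /=.
congr (_ + _).
  rewrite /wderiv mulr_sumr; apply: eq_big => [A|A].
    by case: (i \in A); rewrite ?andbF ?orTb ?andbT.
  move=> /andP[/andP[/andP[cA _] _] iA].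
  rewrite (big_setD1 i) //= /update2 eqxx; congr (_ * _).
  apply: eq_bigr => k; rewrite !inE => /andP[/negbTE-> kA].
  have -> // : (k == j) = false.
  by apply/negP => /eqP kj; apply: (nij A) => //; rewrite -kj.
rewrite /wderiv mulr_sumr; apply: eq_big => [A|A].
  case cA : (clique G A) => //=.
  have := nij A cA; case: (i \in A); case: (j \in A); rewrite ?andbF ?andbT //.
  by move=> /(_ isT isT).
move=> /andP[/andP[/andP[cA _] h] iA].
have jA : j \in A by move: h; rewrite (negbTE iA).
rewrite (big_setD1 j) //= /update2 eqxx eq_sym (negbTE ij); congr (_ * _).
apply: eq_bigr => k; rewrite !inE => /andP[/negbTE-> kA].
have -> // : (k == i) = false.
by apply: contraNF iA => /eqP <-.
Qed.

Lemma update2_self x i j : update2 x i j (x i) (x j) =1 x.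
Proof. by move=> k; rewrite /update2; case: eqP => [->|_] //; case: eqP => [->|]. Qed.

Lemma eq_wcliques s x y : x =1 y -> wcliques s x = wcliques s y.
Proof. by move=> xy; apply: eq_bigr => A _; apply: eq_bigr. Qed.

Lemma wsupp_update2 x i j u v : x i != 0 -> x j != 0 -> i != j ->
  (u == 0) || (v == 0) -> (#|wsupp (update2 x i j u v)| < #|wsupp x|)%N.
Proof.
move=> xi xj ij uv.
apply: proper_card; apply/properP; split.
  apply/subsetP => k; rewrite !inE /update2.
  by case: (k =P i) => [->|_] //; case: (k =P j) => [->|].
case/orP: uv => /eqP->; [exists i|exists j]; rewrite ?inE // /update2.
  by rewrite !eqxx.
by rewrite [j == i]eq_sym (negbTE ij) !eqxx.
Qed.

(** The quantity [u * d1 + v * d2] is linear on the segment of nonnegative pairs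
    [(u, v)] on which [u * b1 + v * b2] is constant.  If [d1 / b1] is the larger
    slope, all the mass is moved to the first coordinate.  When [b1 = 0] the
    segment is unbounded, but then [d1 = 0] and the first weight can be dropped. *)
Lemma segment_endpoint (p q b1 b2 d1 d2 : R) :
  0 <= p -> 0 <= q -> 0 <= b1 -> 0 <= b2 -> 0 <= d1 -> 0 <= d2 ->
  (b1 = 0 -> d1 = 0) -> (b2 = 0 -> d2 = 0) ->
  exists u v, [/\ 0 <= u /\ 0 <= v, (u == 0) || (v == 0),
    u * b1 + v * b2 = p * b1 + q * b2 &
    p * d1 + q * d2 <= u * d1 + v * d2].
Proof.
move=> p0 q0.
wlog le : p q p0 q0 b1 b2 d1 d2 / d2 * b1 <= d1 * b2.
  move=> W b10 b20 d10 d20 z1 z2.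
  case: (lerP (d2 * b1) (d1 * b2)) => [le|/ltW le]; first exact: (W p q).
  have [u [v [[u0 v0] uv E L]]] := W q p q0 p0 b2 b1 d2 d1 le b20 b10 d20 d10 z2 z1.
  exists v, u; split=> //; first by rewrite orbC.
    by rewrite addrC E addrC.
  by rewrite addrC [leRHS]addrC.
move=> b10 b20 d10 d20 z1 z2.
have [b1z|b1n] := eqVneq b1 0.
  exists 0, q; rewrite eqxx b1z (z1 b1z); split=> //.
    by rewrite !mulr0.
  by rewrite !mulr0.
have b1p : 0 < b1 by rewrite lt0r b1n.
exists (p + q * b2 / b1), 0; rewrite eqxx orbT; split=> //.
- by split=> //; rewrite addr_ge0 ?divr_ge0 ?mulr_ge0.
- by field.
- rewrite mul0r addr0 mulrDl lerD2l -(ler_pM2r b1p).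
  have -> : q * b2 / b1 * d1 * b1 = q * (d1 * b2) by field.
  by rewrite -mulrA ler_wpM2l.
Qed.

(** Induction on the size of the support: as long as the support contains two
    nonadjacent vertices, [segment_endpoint] removes one of them from it. *)
Lemma clique_support s x : (0 < s)%N -> (forall i, 0 <= x i) ->
  exists y, [/\ forall i, 0 <= y i, clique G (wsupp y),
    wcliques s y = wcliques s x & wcliques s.+1 x <= wcliques s.+1 y].
Proof.
move=> s0; have [m] := ubnP #|wsupp x|; elim: m x => // m IH x mx x0.
have [cx|] := boolP (clique G (wsupp x)); first by exists x; split.
case/forall_inPn => i; rewrite inE => xi /forall_inPn[j].
rewrite inE => xj; rewrite negb_imply => /andP[ij Gij].
have [u [v [[u0 v0] uv E L]]] := @segment_endpoint (x i) (x j)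
  _ _ _ _ (x0 i) (x0 j) (wderiv_ge0 s i x0) (wderiv_ge0 s j x0)
  (wderiv_ge0 s.+1 i x0) (wderiv_ge0 s.+1 j x0)
  (@wderiv_eq0 s x i s0 x0) (@wderiv_eq0 s x j s0 x0).
have z0 k : 0 <= update2 x i j u v k by rewrite /update2; do 2![case: ifP => // _].
have [|y [y0 cy Ey Ly]] := IH (update2 x i j u v) _ z0.
  exact: leq_trans (wsupp_update2 xi xj ij uv) mx.
have W t : wcliques t x =
    wrest t x i j + x i * wderiv t x i + x j * wderiv t x j.
  by rewrite -wcliques_update2 //; apply/eq_wcliques => k; rewrite update2_self.
exists y; split=> //.
  by rewrite Ey W wcliques_update2 // -!addrA E.
by apply: le_trans Ly; rewrite W wcliques_update2 // -!addrA lerD2l.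
Qed.

Lemma nb_cliques_pow s : (0 < s)%N -> (s < clique_number G)%N ->
  ((nb_cliques G s.+1)%:R / ('C(clique_number G, s.+1))%:R) ^+ s
    <= ((nb_cliques G s)%:R / ('C(clique_number G, s))%:R) ^+ s.+1 :> R.
Proof.
move=> s0 sw.
have [//|y [y0 cy E L]] := @clique_support s (fun=> 1) s0.
rewrite -!wcliques1 -E.
have r0 : all (>= 0) [seq y i | i <- enum (wsupp y)].
  by apply/allP => _ /mapP[i _ ->].
have := @maclaurin_padded _ _ (clique_number G) s r0.
rewrite size_map -cardE -!wcliques_esym // => /(_ (clique_card cy) sw).
apply: le_trans.
have P t : 0 <= wcliques t (fun=> 1) by rewrite wcliques1.
rewrite lerXn2r ?nnegrE ?divr_ge0 //; first exact: le_trans L.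
by rewrite ler_wpM2r // invr_ge0.
Qed.

End WeightedCliques.

Theorem mainTheorem2 (R : realType) (n : nat) (hn : (1 <= n)%N) (G : sgraph n)
    (w : nat) (hw : w = clique_number G) (s : nat) (hs1 : (1 <= s)%N) (hsw : (s < w)%N) :
  ((nb_cliques G s)%:R / ('C(w, s))%:R) `^ (s%:R^-1)
  >= ((nb_cliques G s.+1)%:R / ('C(w, s.+1))%:R) `^ (s.+1%:R^-1) :> R.
Proof.
subst w; have := @nb_cliques_pow R n G s hs1 hsw.
set p := _ / _; set q := _ / _ => h.
have p0 : 0 <= p by rewrite divr_ge0.
have q0 : 0 <= q by rewrite divr_ge0.
have sn : s%:R != 0 :> R by rewrite pnatr_eq0 -lt0n.
have sSn : s.+1%:R != 0 :> R by rewrite pnatr_eq0.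
have -> : s.+1%:R^-1 = s%:R * (s%:R * s.+1%:R)^-1 :> R by rewrite invfM mulVKf.
have -> : s%:R^-1 = s.+1%:R * (s%:R * s.+1%:R)^-1 :> R.
  by rewrite mulrC invfM -mulrA mulVf ?mulr1.
rewrite !powRrM !powR_mulrn //.
by rewrite ge0_ler_powR ?nnegrE ?exprn_ge0 // invr_ge0 mulr_ge0.
Qed.
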